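(* Let $\Gamma_d=\sup_{n\in\mathbb{N}}\max_{\varnothing\ne u\subseteq\{1,\dots,d\}}\sup_{\boldsymbol{k}\in\mathbb{N}_0^u}G_{u,\boldsymbol{k}}(n)$, where $G_{u,\boldsymbol{k}}(n)$ are the gain coefficients of the Halton points. Then $\Gamma_1=1$, and for every integer $d\ge2$, $$\Gamma_d\ \ge\ \frac34\prod_{j=1}^d\frac{b_j+1}{b_j},$$ where $b_j$ is the $j$-th prime.
   Context: $\mathbb{N}=\{1,2,\dots\}$, $\mathbb{N}_0=\mathbb{N}\cup\{0\}$. For $j\in\mathbb{N}$, $b_j$ is the $j$-th prime ($b_1=2,b_2=3,b_3=5,\dots$). For $i\in\mathbb{N}_0$ write $i=\sum_{\ell\ge1}a_{ij\ell}b_j^{\ell-1}$ with base-$b_j$ digits $a_{ij\ell}\in\{0,\dots,b_j-1\}$; the (unscrambled) Halton points are $\boldsymbol{a}_i=(a_{i1},\dots,a_{id})\in[0,1)^d$, $i\in\mathbb{N}_0$, with $a_{ij}=\sum_{\ell\ge1}a_{ij\ell}b_j^{-\ell}$. For $u\subseteq\{1,\dots,d\}$, $\mathbb{N}_0^u$ is the set of vectors $\boldsymbol{k}=(k_j)_{j\in u}$ of nonnegative integers indexed by $u$. For non-empty $u\subseteq\{1,\dots,d\}$, $\boldsymbol{k}\in\mathbb{N}_0^u$ and $n\in\mathbb{N}$, the gain coefficient is $$G_{u,\boldsymbol{k}}(n)=\frac1n\prod_{j\in u}\frac1{b_j-1}\ \sum_{i=0}^{n-1}\sum_{i'=0}^{n-1}\prod_{j\in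 u}\Bigl(b_j\mathbf{1}\{\lfloor b_j^{k_j+1}a_{ij}\rfloor=\lfloor b_j^{k_j+1}a_{i'j}\rfloor\}-\mathbf{1}\{\lfloor b_j^{k_j}a_{ij}\rfloor=\lfloor b_j^{k_j}a_{i'j}\rfloor\}\Bigr),$$ where $\mathbf{1}\{A\}$ is $1$ if $A$ holds and $0$ otherwise. *)

(* Defs.v *)
From HB Require Import structures.
From mathcomp Require Import all_boot all_order all_algebra.
From mathcomp Require Import all_classical all_reals all_analysis.
Set Implicit Arguments.
Unset Strict Implicit.
Unset Printing Implicit Defensive.
Import Order.TTheory GRing.Theory Num.Theory.
Import numFieldNormedType.Exports.
Local Open Scope ring_scope.

Lemma ex_prime_above (m : nat) : exists p : nat, (m < p)%N && prime p.
Proof. by have [p lt_mp pr_p] := prime_above m; exists p; apply/andP. Qed.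

Definition next_prime (m : nat) : nat := ex_minn (ex_prime_above m).

(* Primes are numbered from 0, to match the indices 'I_d: nth_prime 0 = 2,
   nth_prime 1 = 3. *)
Definition nth_prime (j : nat) : nat := iter j next_prime 2%N.

(* The coefficient of b ^ (l - 1) in the base-b expansion of i, for l >= 1. *)
Definition digit (b i l : nat) : nat := ((i %/ b ^ l.-1) %% b)%N.

(* The coordinate of the i-th Halton point in base nth_prime j; the series has
   only finitely many nonzero terms. *)
Definition halton (R : realType) (i j : nat) : R :=
  \big[+%R/0]_(1 <= l <oo)
    ((digit (nth_prime j) i l)%:R / (nth_prime j)%:R ^+ l : R).

(* The indicator that the i-th and i'-th Halton points agree in coordinate j
   to the first r base-b digits, b = nth_prime j. *)
Definition same_cell (R : realType) (j r i i' : nat) : R :=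
  (Num.floor ((nth_prime j)%:R ^+ r * halton R i j) ==
   Num.floor ((nth_prime j)%:R ^+ r * halton R i' j))%:R.

(* G_{u,k}(n); the vector k is indexed by the elements of u only. *)
Definition gain (R : realType) (d : nat) (u : {set 'I_d})
    (k : {j : 'I_d | j \in u} -> nat) (n : nat) : R :=
  n%:R^-1 * (\prod_(j in u) ((nth_prime j)%:R - 1)^-1) *
  \sum_(i < n) \sum_(i' < n) \prod_(j : {j : 'I_d | j \in u})
    ((nth_prime (val j))%:R * same_cell R (val j) (k j).+1 i i'
     - same_cell R (val j) (k j) i i').

(* Gamma_d, taken in the extended reals so that both suprema exist without a
   boundedness proof; for d >= 1 the maximum is over a nonempty family. *)
Definition Gamma (R : realType) (d : nat) : \bar R :=
  ereal_sup [set (\big[maxe/-oo]_(u : {set 'I_d} | u != finset.set0)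
      ereal_sup [set (gain R k n)%:E
                 | k in [set: {j : 'I_d | j \in u} -> nat]])%E
             | n in [set n : nat | (0 < n)%N]].

(* Main.v *)
(** The first [r] base-[b] digits of two Halton coordinates agree exactly when
    [b ^ r] divides [i - i'], so gain coefficients are alternating sums of the
    numbers of pairs [i, i' < n] with [M | i - i'], and
    [M * #pairs = n ^ 2 + r (M - r)] for [r = n mod M].  In dimension 1 this
    bounds every gain by 1, and [n = 1] attains it.  For [d >= 2] take all
    coordinates, [k = 0], and [n] the product of the bases other than 3: every
    squarefree [C] prime to 3 that occurs divides [n], so pairs for [C] are
    equidistributed, while 3 leaves a remainder contributing the factor 2.
    The double sum is [2 * prod (b ^ 2 - 1)] over the bases [b <> 3], and the
    gain is [prod (b + 1) / b] over the same bases; 3/4 is the inverse of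
    the missing factor (3 + 1) / 3. *)
Require Import Defs.
From HB Require Import structures.
From mathcomp Require Import all_boot all_order all_algebra.
From mathcomp Require Import all_classical all_reals all_analysis.
From mathcomp Require Import zify ring lra.
Import Order.TTheory GRing.Theory Num.Theory.
Import numFieldNormedType.Exports.
Local Open Scope ring_scope.

(** * The enumeration of the primes *)

Lemma nth_prime_prime (j : nat) : prime (nth_prime j).
Proof.
case: j => [//|j]; rewrite /nth_prime iterS /next_prime.
by case: ex_minnP => p /andP[].
Qed.

Lemma nth_prime_ltS (j : nat) : (nth_prime j < nth_prime j.+1)%N.
Proof.
rewrite {2}/nth_prime iterS /next_prime -/(nth_prime j).
by case: ex_minnP => p /andP[].
Qed.

Lemma nth_prime_inj : injective nth_prime.
Proof.
exact/incn_inj/leq_mono/(homo_ltn ltn_trans)/nth_prime_ltS.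
Qed.

Lemma nth_prime1 : nth_prime 1 = 3%N.
Proof.
rewrite /nth_prime /= /next_prime; case: ex_minnP => p /andP[p2 _] pmin.
by apply/eqP; rewrite eqn_leq p2 andbT; apply: pmin.
Qed.

(** * Cells of Halton points as residue classes *)

Definition halton_trunc (R : realType) (b m i : nat) : R :=
  \sum_(0 <= l < m) (digit b i l.+1)%:R / b%:R ^+ l.+1.

Lemma digit_small (b i l : nat) : (1 < b)%N -> (i <= l)%N -> digit b i l.+1 = 0%N.
Proof.
move=> b1 il; rewrite /digit /= divn_small ?mod0n //.
exact: leq_ltn_trans il (ltn_expl l b1).
Qed.

Lemma digitS (b i l : nat) : digit b i l.+2 = digit b (i %/ b) l.+1.
Proof. by rewrite /digit /= expnS divnMA. Qed.

(** Since [i < b ^ i], every digit past position [i] vanishes, so the series is eventually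
    constant. *)
Lemma halton_truncE (R : realType) (i j m : nat) : (i <= m)%N ->
  halton R i j = halton_trunc R (nth_prime j) m i.
Proof.
move=> im; have b1 := prime_gt1 (nth_prime_prime j).
apply: cvg_lim => //; apply: cvg_near_cst.
near=> n; rewrite /halton_trunc.
have mn : (m.+1 <= n)%N by near: n; exact: nbhs_infty_ge.
rewrite (big_cat_nat _ mn) //= [X in _ + X]big1_seq.
  by rewrite addr0 big_add1.
case=> [|l] /andP[_]; rewrite mem_index_iota => /andP[] // ml _.
by rewrite digit_small ?mul0r // (leq_trans im).
Unshelve. all: by end_near. Qed.

(** Multiplication by [b] shifts the expansion: the lowest digit of [i] becomes the integer part and
    the other digits are those of [i %/ b]. *)
Lemma halton_truncS (R : realType) (b m i : nat) : (0 < b)%N ->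
  b%:R * halton_trunc R b m.+1 i = (i %% b)%:R + halton_trunc R b m (i %/ b).
Proof.
move=> b0; have bN0 : b%:R != 0 :> R by rewrite pnatr_eq0 -lt0n.
rewrite /halton_trunc big_nat_recl //= mulrDr; congr (_ + _).
  by rewrite /digit expn0 divn1 expr1 mulrC divfK.
rewrite mulr_sumr; apply: eq_bigr => l _; rewrite digitS exprS.
by rewrite invfM mulrCA mulVKf.
Qed.

Lemma halton_trunc_ge0 (R : realType) (b m i : nat) : 0 <= halton_trunc R b m i.
Proof. by apply: sumr_ge0 => l _; rewrite divr_ge0 ?exprn_ge0. Qed.

Lemma halton_trunc_lt1 (R : realType) (b m i : nat) : (0 < b)%N ->
  halton_trunc R b m i < 1.
Proof.
move=> b0; elim: m i => [|m IH] i; first by rewrite /halton_trunc big_geq.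
have b0' : 0 < b%:R :> R by rewrite ltr0n.
rewrite -(ltr_pM2l b0') halton_truncS // mulr1.
have : (i %% b)%:R + 1 <= b%:R :> R by rewrite natr1 ler_nat ltn_mod.
by move: (IH (i %/ b)%N); lra.
Qed.

Lemma floor_halton_truncS (R : realType) (b m r i : nat) : (0 < b)%N ->
  Num.floor (b%:R ^+ r.+1 * halton_trunc R b m.+1 i) =
  (b ^ r * (i %% b))%:Z + Num.floor (b%:R ^+ r * halton_trunc R b m (i %/ b)).
Proof.
move=> b0; rewrite exprSr -mulrA halton_truncS // mulrDr floorDzr; last first.
  by rewrite -natrX -natrM intr_nat.
congr (_ + _); rewrite -natrX -natrM.
by rewrite -[X in Num.floor X]/((_%:Z)%:~R) intrKfloor.
Qed.

(** The truncation lies in [[0, 1)]. The bound [b ^ r] lets [eqn_divmod] separate the lowest digit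
    from the rest of the floor. *)
Lemma floor_halton_trunc_lt (R : realType) (b m r i : nat) : (0 < b)%N ->
  exists2 c : nat, (c < b ^ r)%N &
    Num.floor (b%:R ^+ r * halton_trunc R b m i) = c%:Z.
Proof.
move=> b0; set x := _ * _.
have x0 : 0 <= x by rewrite mulr_ge0 ?exprn_ge0 ?halton_trunc_ge0.
exists `|Num.floor x|%N; last by rewrite gez0_abs // floor_ge0.
rewrite -ltz_nat gez0_abs ?floor_ge0 // floor_lt_int.
rewrite /x -pmulrn natrX -[ltRHS]mulr1 ltr_pM2l ?halton_trunc_lt1 //.
by rewrite exprn_gt0 // ltr0n.
Qed.

Lemma eqn_divmod (D a a' c c' : nat) : (c < D)%N -> (c' < D)%N ->
  (D * a + c == D * a' + c')%N = (a == a') && (c == c').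
Proof.
move=> cD c'D; have D0 : (0 < D)%N by apply: leq_trans cD.
apply/eqP/andP => [E|[/eqP-> /eqP->]//]; rewrite !(mulnC D) in E.
have := congr1 (divn^~ D) E; have := congr1 (modn^~ D) E.
by rewrite /= !divnMDl // !modnMDl !divn_small // !modn_small // !addn0 => -> ->.
Qed.

Lemma eqn_modM (b M i i' : nat) : (0 < b)%N ->
  (i == i' %[mod b * M]) = (i == i' %[mod b]) && (i %/ b == i' %/ b %[mod M]).
Proof.
move=> b0.
have dec x : (x %% (b * M) = b * ((x %/ b) %% M) + x %% b)%N.
  rewrite modn_divl (mulnC M) {1}(divn_eq (x %% (b * M)) b) mulnC.
  by rewrite modn_dvdm // dvdn_mulr.
by rewrite !dec eqn_divmod ?ltn_mod // andbC.
Qed.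

(** Both sides obey the same recursion in [r]: compare the lowest digits, then the quotients by [b]
    with [r] lowered by one. *)
Lemma same_cellE (R : realType) (j r i i' : nat) :
  same_cell R j r i i' = (i == i' %[mod nth_prime j ^ r])%:R.
Proof.
have b0 := prime_gt0 (nth_prime_prime j).
rewrite /same_cell.
(* One truncation length serves both points; its form [r + m] lets the induction on [r] drop one
   digit from it at each step. *)
have im : (i <= r + i + i')%N by lia.
have im' : (i' <= r + i + i')%N by lia.
rewrite (halton_truncE R _ j _ im) (halton_truncE R _ j _ im').
congr ((nat_of_bool _)%:R); rewrite -addnA.
move: (i + i')%N => m {im im'}.
move: (nth_prime j) b0 => b b0; elim: r i i' => [|r IH] i i'.
  have E x : Num.floor (b%:R ^+ 0 * halton_trunc R b (0 + m) x) = 0.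
    have [c] := floor_halton_trunc_lt R b (0 + m) 0 x b0.
    by rewrite expn0 ltnS leqn0 => /eqP->.
  by rewrite !E expn0 !modn1 !eqxx.
rewrite addSn !floor_halton_truncS // expnS eqn_modM // -IH.
have [c cb ->] := floor_halton_trunc_lt R b (r + m) r (i %/ b) b0.
have [c' cb' ->] := floor_halton_trunc_lt R b (r + m) r (i' %/ b) b0.
by rewrite -!PoszD !eqz_nat eqn_divmod.
Qed.

(** * Counting congruent pairs *)

Lemma sum_modn (M q r : nat) (f : nat -> nat) : (r <= M)%N ->
  (\sum_(0 <= i < q * M + r) f (i %% M) =
   q * (\sum_(0 <= a < M) f a) + \sum_(0 <= a < r) f a)%N.
Proof.
move=> rM; have small s : (s <= M)%N ->
    (\sum_(0 <= a < s) f (a %% M) = \sum_(0 <= a < s) f a)%N.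
  move=> sM; rewrite !big_nat; apply: eq_bigr => a /andP[_ aS].
  by rewrite modn_small // (leq_trans aS).
elim: q => [|q IH]; first by rewrite !mul0n !add0n small.
rewrite mulSn -addnA (big_cat_nat (n := M)) ?leq_addr //= small // mulSn -addnA.
congr (_ + _)%N; rewrite -{1}[M]add0n big_addn addKn -IH.
by apply: eq_bigr => a _; rewrite modnDr.
Qed.

(** For [n = q * M + r], [r] residue classes have [q + 1] members below [n] and the other [M - r]
    have [q], which gives [r (q + 1) ^ 2 + (M - r) q ^ 2] pairs. *)
Lemma pairs_eqmod (n M : nat) : (0 < M)%N ->
  (M * \sum_(i < n) \sum_(i' < n) (i == i' %[mod M]) =
   n ^ 2 + n %% M * (M - n %% M))%N.
Proof.
move=> M0; set q := (n %/ M)%N; set r := (n %% M)%N.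
have nE : n = (q * M + r)%N := divn_eq n M.
have rM : (r < M)%N by rewrite ltn_mod.
have count (a s : nat) : (\sum_(0 <= c < s) (a == c) = (a < s))%N.
  by elim: s => [|s IH]; [rewrite big_geq | rewrite big_nat_recr //= IH; lia].
have fiber i : (\sum_(i' < n) (i == i' %[mod M]) = q + (i %% M < r))%N.
  rewrite -(big_mkord xpredT (fun i' => (i == i' %[mod M]) : nat)) nE.
  rewrite (sum_modn M q r (fun c => (i %% M == c)%N : nat)) ?(ltnW rM) //.
  by rewrite !count ltn_mod M0 muln1.
under eq_bigr => i _ do rewrite fiber.
rewrite -(big_mkord xpredT (fun i => q + (i %% M < r))%N) [X in index_iota 0 X]nE.
rewrite (sum_modn M q r (fun c => q + (c < r))%N) ?(ltnW rM) // !big_split /=.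
have lt_sum s : (r <= s)%N -> (\sum_(0 <= c < s) (c < r) = r)%N.
  move=> rs; rewrite (big_cat_nat (n := r)) //= [X in (_ + X)%N]big1_seq.
    by rewrite (eq_big_nat _ _ (F2 := fun=> 1%N)) ?sum_nat_const_nat; lia.
  by move=> c /andP[_]; rewrite mem_index_iota; lia.
rewrite !lt_sum ?(ltnW rM) // !sum_nat_const_nat !subn0 nE; nia.
Qed.

Definition pairs (R : realType) (n M : nat) : R :=
  \sum_(i < n) \sum_(i' < n) (i == i' %[mod M])%:R.

Lemma pairsE (R : realType) (n M : nat) : (0 < M)%N ->
  M%:R * pairs R n M = n%:R ^+ 2 + (n %% M)%:R * (M%:R - (n %% M)%:R).
Proof.
move=> M0; rewrite -(natrB _ (ltnW (ltn_pmod n M0))) -natrX -natrM -natrD -pairs_eqmod //.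
rewrite natrM natr_sum; congr (_ * _); apply: eq_bigr => i _.
by rewrite natr_sum.
Qed.

(** With [r = n %% M], the remainder of [n] modulo [2 * M] is [r] or [r + M]. The left side is then
    [r] or [M - r], and in the second case [M <= n]. *)
Lemma pairs2_le (R : realType) (n M : nat) : (0 < M)%N ->
  2 * pairs R n (2 * M) - pairs R n M <= n%:R.
Proof.
move=> M0; have M0' : 0 < M%:R :> R by rewrite ltr0n.
rewrite -(ler_pM2l M0') mulrBr mulrA [_ * 2]mulrC -natrM !pairsE ?muln_gt0 //.
have rM : (n %% M < M)%N by rewrite ltn_mod.
have [E|E] : (n %% (2 * M) = n %% M \/ n %% (2 * M) = n %% M + M)%N.
  have r2M : (n %% (2 * M) < 2 * M)%N by rewrite ltn_mod muln_gt0.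
  rewrite -(modn_dvdm n (dvdn_mull 2 (dvdnn M))).
  move: (n %% (2 * M))%N r2M => s s2M; have [sM|Ms] := ltnP s M.
    by left; rewrite modn_small.
  by right; rewrite -{2}(subnK Ms) modnDr modn_small ?subnK //; lia.
- rewrite E natrM.
  have rn : (n %% M)%:R <= n%:R :> R by rewrite ler_nat leq_mod.
  by move: (ler_wpM2l (ltW M0') rn); lra.
- rewrite E natrD natrM.
  have Mn : M%:R <= n%:R :> R.
    by rewrite ler_nat; apply: leq_trans (leq_mod n (2 * M)); rewrite E leq_addl.
  have Mr : 0 <= M%:R * (n %% M)%:R :> R by rewrite mulr_ge0.
  by move: (ler_wpM2l (ltW M0') Mn); lra.
Qed.

(** The remainder of [n] modulo [3 * M] is [M] or [2 * M], and [r (3 M - r) = 2 M ^ 2] for both. *)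
Lemma pairs3E (R : realType) (n M : nat) : (0 < M)%N -> (M %| n)%N -> ~~ (3 * M %| n)%N ->
  M%:R * (3 * pairs R n (3 * M) - pairs R n M) = 2 * M%:R ^+ 2.
Proof.
move=> M0 /dvdnP[m ->]; rewrite dvdn_pmul2r // => m3.
rewrite mulrBr mulrA [_ * 3]mulrC -natrM !pairsE ?muln_gt0 //.
rewrite -muln_modl modnMl.
have: (m %% 3 < 3)%N by rewrite ltn_mod.
move: m3; rewrite /dvdn; case: (m %% 3)%N => [//|[|[|//]]] _ _; rewrite !natrM; ring.
Qed.

(* Distributing one factor [b [b | i - i'] - 1] turns the sum for [b :: s] and
   [C] into the difference of the sums for [s] with [C * b] and with [C]. *)
Lemma sum_prod_eqmod (R : realType) (n C : nat) (s : seq nat) : (0 < C)%N ->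
    all (fun b => 0 < b)%N s -> all (coprime C) s -> pairwise coprime s ->
    (C * \prod_(b <- s) b %| n)%N -> ~~ (3 %| n)%N ->
  \sum_(i < n) \sum_(i' < n) C%:R * (i == i' %[mod C])%:R *
    (3 * (i == i' %[mod 3])%:R - 1) *
    \prod_(b <- s) (b%:R * (i == i' %[mod b])%:R - 1) =
  2 * C%:R ^+ 2 * \prod_(b <- s) (b%:R ^+ 2 - 1) :> R.
Proof.
elim: s C => [|b s IH] C C0 /=.
  move=> _ _ _; rewrite !big_nil muln1 mulr1 => Cn n3.
  have co3C : coprime 3 C.
    rewrite prime_coprime //; apply: contra n3 => /dvdn_trans; exact.
  (* Congruence modulo both 3 and [C] is congruence modulo [3 * C], so the sum is the difference in
     [pairs3E]. *)
  rewrite -(@pairs3E R n) //; last by rewrite Gauss_dvd // negb_and n3.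
  rewrite mulrBr mulrA /pairs !mulr_sumr -sumrB; apply: eq_bigr => i _.
  rewrite !mulr_sumr -sumrB; apply: eq_bigr => i' _.
  rewrite big_nil chinese_remainder //.
  by case: (i == i' %[mod 3]); case: (i == i' %[mod C]) => /=; ring.
move=> /andP[b0 s0] /andP[coCb coCs] /andP[cobs cos].
rewrite !big_cons => Cn n3.
have dvdCb : (C * b * \prod_(b <- s) b %| n)%N by rewrite -mulnA.
have dvdC : (C * \prod_(b <- s) b %| n)%N.
  by apply: dvdn_trans Cn; rewrite dvdn_pmul2l // dvdn_mull.
have coCbs : all (coprime (C * b)) s.
  by apply/allP => c cs; rewrite coprimeMl (allP coCs) // (allP cobs).
(* The factor [b ^ 2 - 1] turns [C ^ 2] into [(C b) ^ 2 - C ^ 2], one term for each use of the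
   induction hypothesis. *)
transitivity (2 * (C * b)%:R ^+ 2 * \prod_(b <- s) (b%:R ^+ 2 - 1) -
              2 * C%:R ^+ 2 * \prod_(b <- s) (b%:R ^+ 2 - 1) : R); last first.
  by rewrite natrM; ring.
rewrite -(IH _ _ s0 coCbs cos dvdCb n3) ?muln_gt0 ?C0 //.
rewrite -(IH _ C0 s0 coCs cos dvdC n3) -sumrB; apply: eq_bigr => i _.
rewrite -sumrB; apply: eq_bigr => i' _.
rewrite big_cons chinese_remainder // natrM.
by case: (i == i' %[mod b]); case: (i == i' %[mod C]) => /=; ring.
Qed.

(** * Bounds on the gain coefficients *)

Lemma gain_le1 (R : realType) (u : {set 'I_1})
    (k : {j : 'I_1 | j \in u} -> nat) (n : nat) :
  u != finset.set0 -> (0 < n)%N -> gain R k n <= 1.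
Proof.
move=> /finset.set0Pn[x xu] n0.
pose X : {j : 'I_1 | j \in u} := exist _ x xu.
have all1 (y : {j : 'I_1 | j \in u}) : y = X by apply: val_inj; rewrite /= !ord1.
have x0 : x = ord0 by rewrite ord1.
rewrite /gain (bigD1 x) //= big1 => [|j /andP[_]]; last by rewrite !ord1.
(* The only base is 2, so the normalising factor is 1 and [pairs2_le] applies with [M = 2 ^ k]. *)
rewrite x0 /= mulr1 (_ : 2 - 1 = 1 :> R) ?invr1 ?mulr1; last by ring.
rewrite ler_pdivrMl ?ltr0n // mulr1.
apply: le_trans (pairs2_le R n (2 ^ k X) _); last by rewrite expn_gt0.
rewrite /pairs mulr_sumr -sumrB; apply: ler_sum => i _.
rewrite mulr_sumr -sumrB; apply: ler_sum => i' _.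
rewrite (big_pred1 X) => [|y]; last by rewrite [y]all1 /= eqxx.
by rewrite !same_cellE /= x0 expnS.
Qed.

Lemma le_Gamma (R : realType) (d n : nat) (u : {set 'I_d})
    (k : {j : 'I_d | j \in u} -> nat) :
  u != finset.set0 -> (0 < n)%N -> ((gain R k n)%:E <= Gamma R d)%E.
Proof.
move=> u0 n0.
apply: (le_trans _ (ereal_sup_ubound _)); last by exists n.
pose best (v : {set 'I_d}) := ereal_sup
  [set (gain R l n)%:E | l in [set: {j : 'I_d | j \in v} -> nat]]%classic.
apply: le_trans (le_bigmax_cond _ best u0).
by apply: ereal_sup_ubound; exists k.
Qed.

(** For [k = 0] the subtracted indicator compares no digits, so it is always 1. *)
Lemma gain_setT0 (R : realType) (d n : nat) :
  gain R (fun _ : {j : 'I_d | j \in [set: 'I_d]%SET} => 0%N) n =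
  n%:R^-1 * (\prod_(j < d) ((nth_prime j)%:R - 1)^-1) *
  \sum_(i < n) \sum_(i' < n) \prod_(j < d)
    ((nth_prime j)%:R * (i == i' %[mod nth_prime j])%:R - 1).
Proof.
rewrite /gain; congr (_ * _ * _); first by apply: eq_bigl => j; rewrite finset.in_setT.
apply: eq_bigr => i _; apply: eq_bigr => i' _.
rewrite (reindex (fun j : 'I_d => exist (fun j => j \in [set: 'I_d]%SET) j (finset.in_setT j))).
  by apply: eq_bigr => j _; rewrite !same_cellE expn0 expn1 !modn1 eqxx.
by exists val => // -[j jT] _; apply: val_inj.
Qed.

Lemma Gamma1 (R : realType) : Gamma R 1 = 1%:E.
Proof.
apply/eqP; rewrite eq_le; apply/andP; split.
  apply: ge_ereal_sup => _ [n n0 <-]; apply: bigmax_le => [|u u0].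
    exact: leNye.
  by apply: ge_ereal_sup => _ [k _ <-]; rewrite lee_fin gain_le1.
have u0 : [set: 'I_1]%SET != finset.set0 by apply/finset.set0Pn; exists ord0.
pose k0 (j : {j : 'I_1 | j \in [set: 'I_1]%SET}) := 0%N.
suff <- : gain R k0 1 = 1 by apply: le_Gamma.
rewrite gain_setT0 !big_ord1 eqxx /= invr1 (_ : 2 - 1 = 1 :> R) ?mulr1 //; last by ring.
by field.
Qed.

Theorem mainTheorem2 (R : realType) :
  Gamma R 1 = 1%:E /\
  forall d : nat, (2 <= d)%N ->
    ((3 / 4 * \prod_(j < d) (((nth_prime j)%:R + 1) / (nth_prime j)%:R))%:E
       <= Gamma R d)%E.
Proof.
split=> [|d d2]; first exact: Gamma1.
(* The index of the prime 3, available because [d >= 2]. *)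
pose i1 : 'I_d := Ordinal d2.
have i1_3 : nth_prime i1 = 3%N := nth_prime1.
pose s := [seq nth_prime (val j) | j <- index_enum 'I_d & j != i1].
pose n := (\prod_(b <- s) b)%N.
have ni1 (j : 'I_d) : j != i1 -> nth_prime j != 3%N.
  move=> ji1; rewrite -i1_3 (inj_eq nth_prime_inj).
  by apply: contra ji1 => /eqP j1; apply/eqP/val_inj.
have s_prime : all prime s.
  by apply/allP => _ /mapP[j _ ->]; apply: nth_prime_prime.
have s_gt0 : all (fun b => 0 < b)%N s.
  by apply: sub_all s_prime => b; apply: prime_gt0.
have n_gt0 : (0 < n)%N.
  by rewrite /n big_seq prodn_cond_gt0 // => b /(allP s_gt0).
have s_coprime : pairwise coprime s.
  have : pairwise [rel x y : nat | x != y] s.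
    rewrite -uniq_pairwise map_inj_uniq ?filter_uniq ?index_enum_uniq //.
    by move=> j j' /nth_prime_inj/val_inj.
  apply: (sub_in_pairwise (P := [pred p | prime p])) s_prime => p q pp pq /=.
  by rewrite prime_coprime // dvdn_prime2.
have n3 : ~~ (3 %| n)%N.
  rewrite -prime_coprime // /n big_map big_filter.
  apply: (big_ind (fun m => coprime 3 m)) => // [x y cx cy|j ji1].
    by rewrite coprimeMr cx.
  by rewrite prime_coprime // dvdn_prime2 ?nth_prime_prime // eq_sym ni1.
have -> : 3 / 4 * \prod_(j < d) (((nth_prime j)%:R + 1) / (nth_prime j)%:R) =
    gain R (fun _ : {j : 'I_d | j \in [set: 'I_d]%SET} => 0%N) n.
  rewrite gain_setT0.
  transitivity (n%:R^-1 * (\prod_(j < d) ((nth_prime j)%:R - 1)^-1) *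
      (2 * \prod_(b <- s) (b%:R ^+ 2 - 1)) : R).
    (* The base 3 contributes [3 / 4 * (4 / 3) = 1] on the left and [(3 - 1)^-1 * 2 = 1] on the
       right; the other bases match factor by factor. *)
    rewrite (bigD1 i1) // [X in _ = _ * X * _](bigD1 i1) // i1_3 /=.
    have -> : \prod_(j < d | j != i1) (((nth_prime j)%:R + 1) / (nth_prime j)%:R) =
        n%:R^-1 * (\prod_(j < d | j != i1) ((nth_prime j)%:R - 1)^-1) *
        \prod_(b <- s) (b%:R ^+ 2 - 1) :> R.
      rewrite /n natr_prod -prodfV /s !big_map !big_filter -!big_split /=.
      apply: eq_bigr => j _; have p1 := prime_gt1 (nth_prime_prime j).
      have p0 : (nth_prime j)%:R != 0 :> R by rewrite pnatr_eq0; lia.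
      have p1' : (nth_prime j)%:R - 1 != 0 :> R.
        by rewrite subr_eq0 pnatr_eq1; lia.
      by field; rewrite p0 p1'.
    have nN0 : n%:R != 0 :> R by rewrite pnatr_eq0 -lt0n.
    by field.
  (* Starting from [C = 1], every pair is congruent and no base has been distributed yet. *)
  congr (_ * _); have := @sum_prod_eqmod R n 1 s isT s_gt0.
  rewrite mul1n dvdnn expr1n mulr1 => <- //; last first.
    by apply/allP => b _; rewrite coprime1n.
  apply: eq_bigr => i _; apply: eq_bigr => i' _.
  by rewrite (bigD1 i1) // i1_3 !modn1 eqxx !mul1r /s big_map big_filter.
apply: le_Gamma => //; apply/finset.set0Pn; exists i1; exact: finset.in_setT.
Qed.
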